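(* Let $\mathcal{D}$ be a distribution over samples $(\bm{x},y)$ and $\ell(\bm{w},\bm{x},y)$ a loss differentiable in $\bm{w}\in\mathbb{R}^d$. Suppose there is a function $G(\bm{x},y)\ge0$ with $\|\nabla_{\bm{w}}\ell(\bm{w},\bm{x},y)\|\le G(\bm{x},y)$ for all $\bm{w}\in\mathbb{R}^d$ and all $(\bm{x},y)$ in the support of $\mathcal{D}$, and that for some $k>1$ and $G>0$, $\left(\mathbb{E}_{(\bm{x},y)\sim\mathcal{D}}[G(\bm{x},y)^k]\right)^{1/k}\le G$. Let $\mathcal{Z}=\{(\bm{x}_i,y_i)\}_{i=1}^n$ be i.i.d. from $\mathcal{D}$, $f_i(\bm{w})=\ell(\bm{w},\bm{x}_i,y_i)$, $f=\frac1n\sum_if_i$; suppose $f$ is $L$-smooth (i.e. $\|\nabla f(\bm{w})-\nabla f(\bm{w}')\|\le L\|\bm{w}-\bm{w}'\|$) and attains its minimum on $\mathbb{R}^d$, and take $\mathcal{W}=\mathbb{R}^d$. Fix $\gamma\in(0,1)$, $C>0$, $T\ge1$, and run DP-SGD with $\tau=G\left(\frac{G}{\gamma^2C\sqrt L}\right)^{\frac1{2k-1}}\left(\frac1T+\varphi^2\right)^{-\frac1{2(2k-1)}}$, $\eta_t=\eta=\frac{C}{T\tau\sqrt L}\left(\frac1T+\varphi^2\right)^{-\frac12}$ for all $t<T$, and $\sigma_n^2=\frac{\nu T\log(1/\delta)\tau^2}{n^2\varepsilon^2}$. Then with probability at least $1-\gamma$ over the random dataset $\mathcal{Z}$, $$\mathrm{OR}(T)\le\frac{(\sqrt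 L)^{1-\frac1{2k-1}}G^{1+\frac1{2k-1}}}{\gamma^{\frac2{2k-1}}C^{\frac1{2k-1}}}\left(3C+\frac{2(f(\bm{w}_0)-\min_{\bm{w}\in\mathbb{R}^d}f(\bm{w}))}{C}\right)\left(\frac1T+\varphi^2\right)^{\frac12(1-\frac1{2k-1})}.$$ In particular, for $T=\frac1{\varphi^2}$, $$\mathrm{OR}(T)\le\frac{(\sqrt{2L})^{1-\frac1{2k-1}}G^{1+\frac1{2k-1}}}{\gamma^{\frac2{2k-1}}C^{\frac1{2k-1}}}\left(3C+\frac{2(f(\bm{w}_0)-\min_{\bm{w}}f(\bm{w}))}{C}\right)\varphi^{1-\frac1{2k-1}}.$$
   Context: For $\bm{z}\in\mathbb{R}^d$ and $c>0$, $\mathrm{clip}(\bm{z},c)=\bm{z}\min(1,c/\|\bm{z}\|)$ ($\|\cdot\|$ Euclidean). DP-SGD (unconstrained): given $\bm{w}_0\in\mathbb{R}^d$, $T$, step sizes $\eta_t$, a parameter $b\ge1$, clip norm $\tau$, noise variance $\sigma_n^2$: for $t=0,\dots,T-1$, form $\mathcal{S}_t\subseteq[n]$ by including each index independently with probability $b/n$; $\bm{g}_t=\frac1b\sum_{i\in\mathcal{S}_t}\mathrm{clip}(\nabla f_i(\bm{w}_t),\tau)+\bm{\zeta}_t$, $\bm{\zeta}_t\sim\mathcal{N}(\bm{0},\sigma_n^2I_d)$ independent; $\bm{w}_{t+1}=\bm{w}_t-\eta_t\bm{g}_t$. Output $\bm{w}_{\mathrm{priv}}=\bm{w}_{\widehat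 t}$, $\widehat t$ uniform on $\{0,\dots,T-1\}$. Here $\varepsilon>0$, $\delta\in(0,1)$, $\nu>0$ a fixed absolute constant, $\varphi=\frac{\sqrt{\nu d\log(1/\delta)}}{n\varepsilon}$. The (nonconvex) optimization risk is $\mathrm{OR}(T)=\mathbb{E}[\|\nabla f(\bm{w}_{\mathrm{priv}})\|^2]$, the expectation over the algorithm's randomness conditional on $\mathcal{Z}$. *)

(* Defs.v *)
From HB Require Import structures.
From mathcomp Require Import all_boot all_order all_algebra.
From mathcomp Require Import all_classical all_reals all_analysis.
From mathcomp Require Import normal_distribution.
Set Implicit Arguments. Unset Strict Implicit. Unset Printing Implicit Defensive.
Import Order.TTheory GRing.Theory Num.Def Num.Theory.
Import numFieldNormedType.Exports.
Local Open Scope classical_set_scope.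
Local Open Scope ring_scope.

Section DPSGD.
Context {R : realType}.

Definition enorm (d : nat) (v : 'rV[R]_d) : R := Num.sqrt (\sum_(i < d) v ord0 i ^+ 2).

Definition grad (d : nat) (h : 'rV[R]_d -> R) (w : 'rV[R]_d) : 'rV[R]_d :=
  \row_(i < d) ('D_(delta_mx ord0 i) h w : R).

Definition clip (d : nat) (z : 'rV[R]_d) (c : R) : 'rV[R]_d :=
  Num.min 1 (c / enorm z) *: z.

(* expectation of F(zeta) for zeta ~ N(0, s^2 I_d) (s = standard deviation),
   as the iterated integral over d independent N(0, s^2) coordinates *)
Fixpoint gaussE (s : R) (d : nat) : ('rV[R]_d -> \bar R) -> \bar R :=
  match d return ('rV[R]_d -> \bar R) -> \bar R with
  | 0 => fun F => F 0
  | d'.+1 => fun F =>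
      (\int[normal_prob 0 s]_x gaussE s (fun v : 'rV[R]_d' => F (row_mx (\row_(j < 1) (x : R)) v : 'rV[R]_d'.+1)))%E
  end.

Definition emp_risk (d : nat) (T : Type) (n : nat) (loss : 'rV[R]_d -> T -> R)
  (zs : 'I_n -> T) (w : 'rV[R]_d) : R :=
  n%:R^-1 * \sum_(i < n) loss w (zs i).

(* One DP-SGD step as a Markov operator acting on nonnegative test functions:
   (dpsgd_step h)(w) = E[ h(w - eta * g) ] where
   g = (1/b) sum_{i in S} clip(grad f_i(w), tau) + zeta,
   S Poisson-subsampled with rate b/n, zeta ~ N(0, sigma2 I_d). *)
Definition dpsgd_step (d : nat) (T : Type) (n : nat) (loss : 'rV[R]_d -> T -> R)
  (zs : 'I_n -> T) (b tau eta sigma2 : R) (h : 'rV[R]_d -> \bar R) (w : 'rV[R]_d)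
  : \bar R :=
  (\sum_(S : {set 'I_n})
     ((b / n%:R) ^+ #|S| * (1 - b / n%:R) ^+ (n - #|S|))%:E *
     gaussE (Num.sqrt sigma2)
       (fun zeta : 'rV[R]_d =>
          h (w - eta *: (b^-1 *: (\sum_(i in S) clip (grad (fun u => loss u (zs i)) w) tau)
                         + zeta))%R))%E.

(* OR(T) = E ||grad f(w_priv)||^2 with w_priv = w_{that}, that uniform on {0..T-1}:
   (1/T) sum_{t<T} E ||grad f(w_t)||^2, and E h(w_t) = (step^t h)(w_0). *)
Definition OR (d : nat) (T : Type) (n : nat) (loss : 'rV[R]_d -> T -> R)
  (zs : 'I_n -> T) (w0 : 'rV[R]_d) (Tn : nat) (b tau eta sigma2 : R) : \bar R :=
  ((Tn%:R^-1)%:E *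
   \sum_(t < Tn)
     iter t (dpsgd_step loss zs b tau eta sigma2)
       (fun w => ((enorm (grad (emp_risk loss zs) w)) ^+ 2)%:E) w0)%E.

Definition iid_sample (dO dT : measure_display) (Omega : measurableType dO)
  (T : measurableType dT) (PO : probability Omega R) (P : probability T R)
  (n : nat) (Z : 'I_n -> Omega -> T) : Prop :=
  (forall i, measurable_fun [set: Omega] (Z i)) /\
  forall A : 'I_n -> set T, (forall i, measurable (A i)) ->
    PO [set om | forall i, A i (Z i om)] = (\prod_(i < n) P (A i))%E.

End DPSGD.

(* Main.v *)
(** With gap f = f - min f and eta the step size, U = (2 / eta) gap f is a
    Lyapunov function.  The descent lemma, the two moments of the Gaussian noise
    and the pair probabilities of Poisson sampling give, at every point,

      |grad f|^2 + E[U(next iterate)]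
        <= U + |bias|^2 + L eta (2 tau^2 + d sigma^2),

    where the bias is the distance from grad f to the average of the clipped
    gradients.  Telescoping bounds OR(T).  The bias is at most the sample average
    of G_i^k divided by tau^(k-1), hence at most G^k / (gamma tau^(k-1)) outside
    an event of probability gamma, by Markov's inequality; tau makes the square
    of this bound equal to C sqrt(L) tau sqrt(1/T + phi^2).

    The iterates E[h(w_t)] are integrals of functions whose measurability is not
    available for free.  For nonnegative functions the integral is a supremum
    over simple functions below, so monotonicity and superadditivity hold without
    measurability, and these are all that the telescoping needs. *)

Require Import Defs.
From HB Require Import structures.
From mathcomp Require Import all_boot all_order all_algebra.
From mathcomp Require Import all_classical all_reals all_analysis.
From mathcomp Require Import normal_distribution.
From mathcomp Require Import measurable_realfun.
From mathcomp Require Import ring lra.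
Import Order.TTheory GRing.Theory Num.Def Num.Theory.
Import numFieldNormedType.Exports.
Local Open Scope classical_set_scope.
Local Open Scope ring_scope.

(** * Integrals of nonnegative functions that need not be measurable *)

Section lower_integral.
Context {d : measure_display} {T : measurableType d} {R : realType}.
Variable mu : {measure set T -> \bar R}.
Implicit Types f g : T -> \bar R.
Local Open Scope ereal_scope.
Import HBNNSimple.

Lemma ge0_le_integral_nomeas f g : (forall x, 0 <= f x) ->
  (forall x, f x <= g x) -> \int[mu]_x f x <= \int[mu]_x g x.
Proof.
move=> f0 fg; have g0 x : 0 <= g x by exact: le_trans (fg x).
rewrite !ge0_integralTE//; apply: ereal_sup_le => _ [h /= hf <-].
by exists h => // x; exact: le_trans (fg x).
Qed.

(** If [h] and [k] are simple functions below [f] and [g], then [h + k] is a simple function below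
    [f + g]. The two suprema are taken one after the other by subtracting on the right, so the case
    of an infinite right-hand side is split off first. *)
Lemma ge0_integral_superD f g : (forall x, 0 <= f x) -> (forall x, 0 <= g x) ->
  \int[mu]_x f x + \int[mu]_x g x <= \int[mu]_x (f x + g x).
Proof.
move=> f0 g0; have fg0 x : 0 <= f x + g x by exact: adde_ge0.
have ig0 : 0 <= \int[mu]_x g x by exact: integral_ge0.
have [->|Cy] := eqVneq (\int[mu]_x (f x + g x)) +oo; first by rewrite leey.
have Cfin : \int[mu]_x (f x + g x) \is a fin_num.
  by rewrite ge0_fin_numE ?lt_neqAle ?Cy ?leey//; exact: integral_ge0.
have igfin : \int[mu]_x g x \is a fin_num.
  rewrite ge0_fin_numE//; apply: le_lt_trans (_ : _ < +oo); last first.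
    by rewrite -ge0_fin_numE; [exact: Cfin|exact: integral_ge0].
  by apply: ge0_le_integral_nomeas => // x; rewrite leeDr.
rewrite -leeBrDr// [leLHS]ge0_integralTE//.
apply: ge_ereal_sup => _ [h /= hf <-].
have hfin : sintegral mu h \is a fin_num.
  rewrite ge0_fin_numE ?sintegral_ge0//; apply: le_lt_trans (_ : _ < +oo); last first.
    by rewrite -ge0_fin_numE; [exact: Cfin|exact: integral_ge0].
  rewrite -integralT_nnsfun; apply: ge0_le_integral_nomeas => x.
    by rewrite lee_fin.
  by rewrite (le_trans (hf x))// leeDl.
rewrite leeBrDr// addeC -leeBrDr// [leLHS]ge0_integralTE//.
apply: ge_ereal_sup => _ [k /= kg <-].
rewrite leeBrDr// addeC -sintegralD// -integralT_nnsfun.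
apply: ge0_le_integral_nomeas => x; rewrite ?lee_fin ?addr_ge0//.
by rewrite EFinD leeD.
Qed.

End lower_integral.

(** * First and second moments of a centred Gaussian on the line *)

Section normal_moments.
Context {R : realType}.
Implicit Types s r lam : R.
Local Notation mu := (@lebesgue_measure R).

(** The Radon-Nikodym derivative of [normal_prob] and [normal_pdf] have the same integral over every
    measurable set, so they agree almost everywhere. *)
Lemma ge0_integral_normal_prob s (f : R -> \bar R) :
  (forall x, 0 <= f x)%E -> measurable_fun [set: R] f ->
  (\int[normal_prob 0 s]_x f x = \int[mu]_x (f x * (normal_pdf 0 s x)%:E))%E.
Proof.
move=> f0 mf; have dom := normal_prob_dominates (0 : R) s.
rewrite -(Radon_Nikodym_SigmaFinite.change_of_variables dom)//.
apply: ae_eq_integral => //.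
- apply: emeasurable_funM => //; apply: (measurable_int mu).
  exact: Radon_Nikodym_SigmaFinite.f_integrable.
- apply: emeasurable_funM => //; apply/measurable_EFinP.
  exact: measurable_normal_pdf.
- apply: ae_eqe_mul2l; apply: integral_ae_eq => //.
  + exact: Radon_Nikodym_SigmaFinite.f_integrable.
  + by apply/measurable_EFinP; exact: measurable_normal_pdf.
  + by move=> E _ mE; rewrite -Radon_Nikodym_SigmaFinite.f_integral.
Qed.

(* Completing the square turns an exponentially tilted Gaussian density into
   another Gaussian density. *)
Lemma integral_normal_prob_expR_linear s lam : 0 < s ->
  (\int[normal_prob 0 s]_x (expR (lam * x))%:E =
   (expR (lam ^+ 2 * s ^+ 2 / 2))%:E)%E.
Proof.
move=> s0; rewrite ge0_integral_normal_prob; first last.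
- by apply/measurable_EFinP/measurableT_comp => //; exact: measurable_funM.
- by move=> x; rewrite lee_fin expR_ge0.
under eq_integral => x _.
  have -> : ((expR (lam * x))%:E * (normal_pdf 0 s x)%:E =
    (expR (lam ^+ 2 * s ^+ 2 / 2))%:E * (normal_pdf (lam * s ^+ 2) s x)%:E)%E.
    rewrite -!EFinM !normal_pdfE ?gt_eqF// /normal_fun mulrCA -expRD.
    rewrite [in RHS]mulrCA -expRD; congr (_ * expR _)%:E.
    by field; rewrite gt_eqF.
  over.
rewrite integralZl//= ?integral_normal_pdf ?mule1//.
exact: integrable_normal_pdf.
Qed.

(** The coefficient of [x ^+ 2] is such that the tilted density is [r^-1] times the Gaussian density
    of standard deviation [s / r]. *)
Lemma integral_normal_prob_expR_sqr s r : 0 < s -> 0 < r ->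
  (\int[normal_prob 0 s]_x (expR ((1 - r ^+ 2) / (2 * s ^+ 2) * x ^+ 2))%:E =
   r^-1%:E)%E.
Proof.
move=> s0 r0; rewrite ge0_integral_normal_prob; first last.
- apply/measurable_EFinP/measurableT_comp => //; exact: measurable_funM.
- by move=> x; rewrite lee_fin expR_ge0.
under eq_integral => x _.
  have -> : ((expR ((1 - r ^+ 2) / (2 * s ^+ 2) * x ^+ 2))%:E
      * (normal_pdf 0 s x)%:E = r^-1%:E * (normal_pdf 0 (s / r) x)%:E)%E.
    have sr0 : 0 < s / r by rewrite divr_gt0.
    rewrite -!EFinM !normal_pdfE ?gt_eqF// /normal_fun mulrCA -expRD.
    rewrite [in RHS]mulrA; congr (_ * expR _)%:E; last first.
      by field; rewrite !gt_eqF.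
    rewrite /normal_peak (_ : (s / r) ^+ 2 * pi *+ 2 =
      r^-1 ^+ 2 * (s ^+ 2 * pi *+ 2)); last by field; rewrite gt_eqF.
    rewrite sqrtrM ?sqr_ge0// sqrtr_sqr gtr0_norm ?invr_gt0// invfM invrK mulKf//.
    by rewrite gt_eqF.
  over.
rewrite integralZl//= ?integral_normal_pdf ?mule1//.
exact: integrable_normal_pdf.
Qed.

Lemma integral_normal_prob_sqr_ge0 s : (0 <= \int[normal_prob 0 s]_x (x ^+ 2)%:E)%E.
Proof. by apply: integral_ge0 => x _; rewrite lee_fin sqr_ge0. Qed.

(** Integrating [1 + t x^2 <= exp (t x^2)] at [t = (1 - r^2) / (2 s^2)] bounds the second moment by
    [2 s^2 / (r (1 + r))], which tends to [s^2] as [r] tends to 1. An explicit [r] replaces the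
    limit. *)
Lemma integral_normal_prob_sqr_le s : 0 < s ->
  (\int[normal_prob 0 s]_x (x ^+ 2)%:E <= (s ^+ 2)%:E)%E.
Proof.
move=> s0; set M := (X in (X <= _)%E).
have M0 : (0 <= M)%E by exact: integral_normal_prob_sqr_ge0.
have key r : 0 < r < 1 ->
    (1%:E + ((1 - r ^+ 2) / (2 * s ^+ 2))%:E * M <= r^-1%:E)%E.
  move=> /andP[r0 r1]; rewrite -(integral_normal_prob_expR_sqr s r)//.
  have t0 : 0 <= (1 - r ^+ 2) / (2 * s ^+ 2).
    apply: divr_ge0; last by rewrite mulr_ge0 ?sqr_ge0.
    by rewrite subr_ge0 expr_le1// ltW.
  have mx2 : measurable_fun [set: R] (fun x : R => (x ^+ 2)%:E).
    by apply/measurable_EFinP; exact: measurable_funX.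
  rewrite /M -ge0_integralZl_EFin//; last by move=> x _; rewrite lee_fin sqr_ge0.
  have <- : (\int[normal_prob 0 s]_x (1 : \bar R) = 1)%E.
    by rewrite integral_cst//= mul1e -(@probability_setT _ _ R (normal_prob 0 s)).
  rewrite -ge0_integralD//=.
  - apply: ge0_le_integral => //=.
    + by move=> x _; rewrite adde_ge0 ?mule_ge0 ?lee_fin ?sqr_ge0.
    + by apply: emeasurable_funD => //; exact: emeasurable_funM.
    + apply/measurable_EFinP/measurableT_comp => //; exact: measurable_funM.
    + by move=> x _; rewrite -EFinM -EFinD lee_fin expR_ge1Dx.
  - by move=> x _; rewrite mule_ge0 ?lee_fin ?sqr_ge0.
  - exact: emeasurable_funM.
have Mfin : M \is a fin_num.
  rewrite ge0_fin_numE//.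
  (* Any single [r] in the interval already forces the moment to be finite. *)
  have /key : 0 < (2^-1 : R) < 1 by apply/andP; split; lra.
  rewrite ltNge leye_eq => h; apply/negP => /eqP My; move: h; rewrite My.
  rewrite gt0_muley ?lte_fin; first by rewrite addey.
  by rewrite divr_gt0 ?mulr_gt0 ?exprn_gt0//; lra.
rewrite -(fineK Mfin) lee_fin leNgt; apply/negP => sM.
set m := fine M in sM *; have m0 : 0 < m by rewrite (lt_trans _ sM)// exprn_gt0.
pose q := s ^+ 2 / m; have q0 : 0 < q by rewrite divr_gt0// exprn_gt0.
have q1 : q < 1 by rewrite ltr_pdivrMr// mul1r.
(* A contradiction needs [r (1 + r) > 2 q] with [r < 1]; for this [r] the difference is
   [(1 - q) (21 - q) / 16]. *)
pose r := (3 + q) / 4.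
have r01 : 0 < r < 1 by rewrite /r; apply/andP; split; lra.
have := key _ r01; rewrite -(fineK Mfin) -EFinM -EFinD lee_fin -/m.
have -> : s ^+ 2 = q * m by rewrite /q divfK ?gt_eqF.
have -> : (1 - r ^+ 2) / (2 * (q * m)) * m = (1 - r ^+ 2) / (2 * q).
  by field; rewrite !gt_eqF.
move: r01 => /andP[r0 r1].
apply/negP; rewrite -ltNge -subr_gt0.
have -> : 1 + (1 - r ^+ 2) / (2 * q) - r^-1 =
    (1 - r) * (r * (1 + r) - 2 * q) / (2 * q * r).
  by field; rewrite !gt_eqF.
apply: divr_gt0; last by apply: mulr_gt0 => //; exact: mulr_gt0.
have q21 : 0 < (1 - q) * (21 - q) by apply: mulr_gt0; lra.
apply: mulr_gt0; first by rewrite /r; lra.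
by rewrite (_ : _ - _ = (1 - q) * (21 - q) / 16) ?divr_gt0// /r; field.
Qed.

Lemma integrable_normal_prob_sqr s : 0 < s ->
  (normal_prob 0 s).-integrable [set: R] (fun x => (x ^+ 2)%:E).
Proof.
move=> s0; apply/integrableP; split.
  by apply/measurable_EFinP; exact: measurable_funX.
under eq_integral do rewrite gee0_abs ?lee_fin ?sqr_ge0//.
exact: le_lt_trans (integral_normal_prob_sqr_le s s0) (ltry _).
Qed.

Lemma integrable_normal_prob_id s : 0 < s ->
  (normal_prob 0 s).-integrable [set: R] (fun x => x%:E).
Proof.
move=> s0.
have i1 : (normal_prob 0 s).-integrable [set: R] (fun=> 1%E : \bar R).
  exact: finite_measure_integrable_cst.
have := integrableD measurableT i1 (integrable_normal_prob_sqr s s0).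
apply: le_integrable => //; first exact/measurable_EFinP.
move=> x _ /=; rewrite lee_fin [leRHS]ger0_norm ?addr_ge0 ?sqr_ge0//.
by rewrite ler_norml; apply/andP; split; nra.
Qed.

(** Integrating [1 + lam x <= exp (lam x)] gives [1 + lam m <= exp (lam^2 s^2 / 2)] for every real
    [lam]. Near 0 the right side exceeds 1 only quadratically, so the slope [m] vanishes. *)
Lemma integral_normal_prob_id s : 0 < s -> (\int[normal_prob 0 s]_x x%:E = 0)%E.
Proof.
move=> s0; have ix := integrable_normal_prob_id s s0.
have Mfin : (\int[normal_prob 0 s]_x x%:E)%E \is a fin_num.
  exact: integrable_fin_num.
rewrite -[LHS]fineK//; congr EFin.
set M := (\int[_]_x _)%E in Mfin *.
have key lam : 1 + lam * fine M <= expR (lam ^+ 2 * s ^+ 2 / 2).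
  rewrite -lee_fin -integral_normal_prob_expR_linear// EFinD EFinM fineK//.
  rewrite /M -integralZl//.
  have <- : (\int[normal_prob 0 s]_x (1 : \bar R) = 1)%E.
    by rewrite integral_cst//= mul1e -(@probability_setT _ _ R (normal_prob 0 s)).
  have i1 : (normal_prob 0 s).-integrable [set: R] (fun=> 1%E : \bar R).
    exact: finite_measure_integrable_cst.
  have iz : (normal_prob 0 s).-integrable [set: R] (fun x => lam%:E * x%:E)%E.
    exact: integrableZl.
  rewrite -integralD//; apply: le_integral => //=.
  - exact: integrableD.
  - apply/integrableP; split.
      by apply/measurable_EFinP/measurableT_comp => //; exact: measurable_funM.
    under eq_integral do rewrite gee0_abs ?lee_fin ?expR_ge0//.
    by rewrite integral_normal_prob_expR_linear// ltry.
  - by move=> x _; rewrite -EFinM -EFinD lee_fin expR_ge1Dx.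
set m := fine M in key *.
(* Multiplying by [1 - u <= expR (- u)] removes the exponential; this needs [u <= 1], whence the
   second alternative. *)
have {}key lam : (1 + lam * m) * (1 - lam ^+ 2 * s ^+ 2 / 2) <= 1 \/ 1 < lam ^+ 2 * s ^+ 2 / 2.
  set u := _ / 2; case: (ltP 1 u) => [|u1]; [by right|left].
  apply: le_trans (_ : expR u * expR (- u) <= 1); last by rewrite -expRD subrr expR0.
  apply: (@le_trans _ _ (expR u * (1 - u))).
    by rewrite ler_wpM2r ?subr_ge0//; exact: key.
  by rewrite ler_wpM2l ?expR_ge0// expR_ge1Dx.
have [//|m0] := eqVneq m 0; exfalso.
have m2 : 0 < m ^+ 2 by rewrite exprn_even_gt0.
have s2 : 0 < s ^+ 2 by rewrite exprn_gt0.
(* At lam = m / (m^2 + 2 s^2) the bound of [key] is violated. *)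
pose D := m ^+ 2 + 2 * s ^+ 2; have D0 : 0 < D by rewrite addr_gt0// mulr_gt0.
pose p := m ^+ 2 / D; pose v := s ^+ 2 / D.
have pv : p + 2 * v = 1 by rewrite /p /v /D; field; rewrite gt_eqF.
have p0 : 0 < p by rewrite divr_gt0.
have v0 : 0 < v by rewrite divr_gt0.
have := key (m / D).
have -> : m / D * m = p by rewrite /p expr2 mulrAC.
have -> : (m / D) ^+ 2 * s ^+ 2 = p * v by rewrite /p /v; field; rewrite gt_eqF.
by case; nra.
Qed.

End normal_moments.

(** * Expectation under isotropic Gaussian noise *)

Section gaussian_expectation.
Context {R : realType}.
Local Open Scope ereal_scope.

Lemma gaussE_ge0 (s : R) d (F : 'rV[R]_d -> \bar R) :
  (forall v, 0 <= F v) -> 0 <= gaussE s F.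
Proof.
elim: d F => [|d IHd] F F0 //=.
by apply: integral_ge0 => x _; exact: IHd.
Qed.

Lemma le_gaussE (s : R) d (F H : 'rV[R]_d -> \bar R) :
  (forall v, 0 <= F v) -> (forall v, F v <= H v) -> gaussE s F <= gaussE s H.
Proof.
elim: d F H => [|d IHd] F H F0 FH //=.
apply: ge0_le_integral_nomeas => x; first exact: gaussE_ge0.
exact: IHd.
Qed.

Lemma gaussE_superD (s : R) d (F H : 'rV[R]_d -> \bar R) :
  (forall v, 0 <= F v) -> (forall v, 0 <= H v) ->
  gaussE s F + gaussE s H <= gaussE s (fun v => F v + H v).
Proof.
elim: d F H => [|d IHd] F H F0 H0 //=.
apply: le_trans; first by apply: ge0_integral_superD => x; exact: gaussE_ge0.
apply: ge0_le_integral_nomeas => x; last exact: IHd.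
by rewrite adde_ge0//; exact: gaussE_ge0.
Qed.

Lemma integral_normal_prob_quadratic_le (s a b c : R) : (0 < s)%R -> (0 <= c)%R ->
  \int[normal_prob 0 s]_x (a + b * x + c * x ^+ 2)%:E <= (a + c * s ^+ 2)%:E.
Proof.
move=> s0 c0.
have i1 : (normal_prob 0 s).-integrable [set: R] (fun=> a%:E).
  exact: finite_measure_integrable_cst.
have ib : (normal_prob 0 s).-integrable [set: R] (fun x => b%:E * x%:E).
  by apply: integrableZl => //; exact: integrable_normal_prob_id.
have ic : (normal_prob 0 s).-integrable [set: R] (fun x => c%:E * (x ^+ 2)%:E).
  by apply: integrableZl => //; exact: integrable_normal_prob_sqr.
under eq_integral do rewrite !EFinD !EFinM.
rewrite integralD//=; last exact: integrableD.
rewrite integralD// !integralZl//; first last.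
- exact: integrable_normal_prob_id.
- exact: integrable_normal_prob_sqr.
rewrite integral_normal_prob_id// mule0 adde0 integral_cst//=.
rewrite (@probability_setT _ _ R (normal_prob 0 s)) mule1 EFinD EFinM leeD2l//.
by rewrite lee_wpmul2l ?lee_fin ?integral_normal_prob_sqr_le.
Qed.

(** Induction on the coordinates: the terms in the first coordinate [x] join the constant while the
    others are integrated out, and a one-dimensional quadratic in [x] remains. Only the majorant has
    to be measurable, and [0 <= c] lets an upper bound on the second moment suffice. *)
Lemma gaussE_le_quadratic (s : R) d (F : 'rV[R]_d -> \bar R)
    (a : R) (b : 'I_d -> R) (c : R) : (0 < s)%R -> (0 <= c)%R ->
  (forall v, 0 <= F v) ->
  (forall v : 'rV[R]_d, F v <=
    (a + \sum_i b i * v ord0 i + c * \sum_i v ord0 i ^+ 2)%:E) ->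
  gaussE s F <= (a + c * (d%:R * s ^+ 2))%:E.
Proof.
move=> s0 c0; elim: d F a b => [|d IHd] F a b F0 Fle /=.
  by rewrite (le_trans (Fle 0%R))// !big_ord0 mulr0 mul0r mulr0 addr0.
apply: (@le_trans _ _ (\int[normal_prob 0 s]_x
    ((a + c * (d%:R * s ^+ 2)) + b (lshift d (@ord0 0)) * x + c * x ^+ 2)%:E)).
  apply: ge0_le_integral_nomeas => x; first exact: gaussE_ge0.
  apply: le_trans; first apply: (IHd _
    (a + b (lshift d (@ord0 0)) * x + c * x ^+ 2)%R (fun i => b (rshift 1 i))) => //.
    move=> v; pose z : 'rV[R]_(1 + d) := row_mx (\row_(_ < 1) (x : R)) v.
    have zl : z ord0 (lshift d ord0) = x by rewrite row_mxEl mxE.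
    have zr i : z ord0 (rshift 1 i) = v ord0 i by rewrite row_mxEr.
    apply: (le_trans (Fle z)); rewrite lee_fin.
    rewrite !(@big_split_ord _ _ _ 1 d)/= !big_ord1.
    under eq_bigr do rewrite zr.
    under [X in (c * (_ + X))%R]eq_bigr do rewrite zr.
    by rewrite zl -subr_le0 [leLHS](_ : _ = 0)%R//; ring.
  by rewrite lee_fin -subr_le0 [leLHS](_ : _ = 0)%R//; ring.
apply: (le_trans (integral_normal_prob_quadratic_le _ _ _ _ s0 c0)).
by rewrite lee_fin -addrA -mulrDr -[in leRHS]natr1 mulrDl mul1r.
Qed.

End gaussian_expectation.

(** * The DP-SGD step as a monotone superadditive operator *)

Section dpsgd_operator.
Context {R : realType} (d n : nat) (T : Type) (loss : 'rV[R]_d -> T -> R).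
Variables (zs : 'I_n -> T) (b tau eta sigma2 : R).
Hypothesis b01 : 0 <= b / n%:R <= 1.
Implicit Types (h : 'rV[R]_d -> \bar R) (w : 'rV[R]_d).
Local Notation step := (dpsgd_step loss zs b tau eta sigma2).
Local Open Scope ereal_scope.

Lemma poisson_weight_ge0 (S : {set 'I_n}) :
  (0 <= (b / n%:R) ^+ #|S| * (1 - b / n%:R) ^+ (n - #|S|))%R.
Proof. by case/andP: b01 => p0 p1; rewrite mulr_ge0// exprn_ge0// subr_ge0. Qed.

Lemma dpsgd_step_ge0 h w : (forall u, 0 <= h u) -> 0 <= step h w.
Proof.
move=> h0; apply: sume_ge0 => S _; rewrite mule_ge0//.
  by rewrite lee_fin poisson_weight_ge0.
by apply: gaussE_ge0 => v.
Qed.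

Lemma iter_dpsgd_step_ge0 t h w : (forall u, 0 <= h u) -> 0 <= iter t step h w.
Proof. by elim: t w => [|t IHt] w h0 //=; apply: dpsgd_step_ge0 => u; exact: IHt. Qed.

Lemma le_dpsgd_step h k w : (forall u, 0 <= h u) -> (forall u, h u <= k u) ->
  step h w <= step k w.
Proof.
move=> h0 hk; apply: lee_sum => S _; rewrite lee_wpmul2l//.
  by rewrite lee_fin poisson_weight_ge0.
exact: le_gaussE.
Qed.

Lemma dpsgd_step_superD h k w : (forall u, 0 <= h u) -> (forall u, 0 <= k u) ->
  step h w + step k w <= step (fun u => h u + k u) w.
Proof.
move=> h0 k0; rewrite /dpsgd_step -big_split; apply: lee_sum => S _ /=.
rewrite -ge0_muleDr; [|exact: gaussE_ge0|exact: gaussE_ge0].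
rewrite lee_wpmul2l//; first by rewrite lee_fin poisson_weight_ge0.
exact: gaussE_superD.
Qed.

Lemma dpsgd_step_super_sum m (h : 'I_m -> 'rV[R]_d -> \bar R) w :
  (forall t u, 0 <= h t u) ->
  \sum_t step (h t) w <= step (fun u => \sum_t h t u) w.
Proof.
elim: m h => [|m IHm] h h0.
  by rewrite big_ord0; apply: dpsgd_step_ge0 => u; rewrite big_ord0.
rewrite big_ord_recl; under [X in _ <= step X w]eq_fun do rewrite big_ord_recl.
apply: le_trans; last apply: dpsgd_step_superD => //.
  by rewrite leeD2l//; apply: IHm.
by move=> u; exact: sume_ge0.
Qed.

(* Telescoping: U is a Lyapunov function dominating its own expected decrease h,
   up to the additive error c per step. *)
Lemma sum_iter_dpsgd_step_le (h : 'rV[R]_d -> \bar R) (U : 'rV[R]_d -> R) (c : R) :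
  (forall u, 0 <= h u) -> (forall u, 0 <= U u)%R -> (0 <= c)%R ->
  (forall m w, h w + step (fun u => (U u + m%:R * c)%:E) w <= (U w + m.+1%:R * c)%:E) ->
  forall m w, \sum_(t < m) iter t step h w <= (U w + m%:R * c)%:E.
Proof.
move=> h0 U0 c0 decr; elim=> [|m IHm] w.
  by rewrite big_ord0 mul0r addr0 lee_fin.
apply: le_trans (decr m w); rewrite big_ord_recl/= leeD2l//.
(* The terms after the first all have an outermost [step]; superadditivity moves the sum under it,
   where the induction hypothesis applies. *)
apply: le_trans; first by apply: dpsgd_step_super_sum => t u; exact: iter_dpsgd_step_ge0.
by apply: le_dpsgd_step => // u; apply: sume_ge0 => t _; exact: iter_dpsgd_step_ge0.
Qed.

End dpsgd_operator.

(** * Euclidean geometry and the clipping error *)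

Section euclidean.
Context {R : realType} {d : nat}.
Implicit Types (u v w z : 'rV[R]_d).

Definition dotv u v : R := \sum_(i < d) u ord0 i * v ord0 i.

Lemma dotvC u v : dotv u v = dotv v u.
Proof. by apply: eq_bigr => i _; rewrite mulrC. Qed.

Lemma dotvDl u v w : dotv (u + v) w = dotv u w + dotv v w.
Proof. by rewrite -big_split; apply: eq_bigr => i _; rewrite mxE mulrDl. Qed.

Lemma dotvDr u v w : dotv w (u + v) = dotv w u + dotv w v.
Proof. by rewrite dotvC dotvDl !(dotvC w). Qed.

Lemma dotvZl (a : R) u v : dotv (a *: u) v = a * dotv u v.
Proof. by rewrite mulr_sumr; apply: eq_bigr => i _; rewrite mxE mulrA. Qed.

Lemma dotvZr (a : R) u v : dotv u (a *: v) = a * dotv u v.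
Proof. by rewrite dotvC dotvZl dotvC. Qed.

Lemma dotvNl u v : dotv (- u) v = - dotv u v.
Proof. by rewrite -scaleN1r dotvZl mulN1r. Qed.

Lemma dotvNr u v : dotv u (- v) = - dotv u v.
Proof. by rewrite dotvC dotvNl dotvC. Qed.

Lemma dotvBl u v w : dotv (u - v) w = dotv u w - dotv v w.
Proof. by rewrite dotvDl dotvNl. Qed.

Lemma dotvBr u v w : dotv w (u - v) = dotv w u - dotv w v.
Proof. by rewrite dotvC dotvBl !(dotvC w). Qed.

Lemma dotv0l u : dotv 0 u = 0.
Proof. by rewrite -(scale0r 0) dotvZl mul0r. Qed.

Lemma dotv_suml (I : finType) (P : pred I) (F : I -> 'rV[R]_d) v :
  dotv (\sum_(i | P i) F i) v = \sum_(i | P i) dotv (F i) v.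
Proof.
by elim/big_rec2 : _ => [|i x y _ <-]; [rewrite dotv0l|rewrite dotvDl].
Qed.

Lemma dotv_sumr (I : finType) (P : pred I) (F : I -> 'rV[R]_d) v :
  dotv v (\sum_(i | P i) F i) = \sum_(i | P i) dotv v (F i).
Proof. by rewrite dotvC dotv_suml; apply: eq_bigr => i _; rewrite dotvC. Qed.

Lemma dotvv_ge0 u : 0 <= dotv u u.
Proof. by apply: sumr_ge0 => i _; rewrite -expr2 sqr_ge0. Qed.

Lemma sqr_enorm u : enorm u ^+ 2 = dotv u u.
Proof.
rewrite sqr_sqrtr; last by apply: sumr_ge0 => i _; rewrite sqr_ge0.
by apply: eq_bigr => i _; rewrite expr2.
Qed.

Lemma enorm_ge0 u : 0 <= enorm u. Proof. exact: sqrtr_ge0. Qed.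

Lemma enorm0_eq0 u : enorm u = 0 -> u = 0.
Proof.
move=> /(congr1 (fun x => x ^+ 2)); rewrite sqr_enorm expr0n/= => /eqP.
rewrite psumr_eq0; last by move=> i _; rewrite -expr2 sqr_ge0.
move=> /allP u0; apply/rowP => i; rewrite mxE; apply/eqP.
by have := u0 i (mem_index_enum _); rewrite -expr2 sqrf_eq0.
Qed.

Lemma enormZ (a : R) u : enorm (a *: u) = `|a| * enorm u.
Proof.
apply/eqP; rewrite -(@eqrXn2 _ 2) ?mulr_ge0 ?enorm_ge0//.
by rewrite exprMn !sqr_enorm dotvZl dotvZr mulrA -expr2 real_normK ?num_real.
Qed.

(** Cauchy-Schwarz: the squared norm of [|v| u - |u| v] is [2 |u| |v| (|u| |v| - <u, v>)]. *)
Lemma dotv_le u v : dotv u v <= enorm u * enorm v.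
Proof.
have [/enorm0_eq0 ->|u0] := eqVneq (enorm u) 0.
  by rewrite dotv0l mulr_ge0 ?enorm_ge0.
have [/enorm0_eq0 ->|v0] := eqVneq (enorm v) 0.
  by rewrite dotvC dotv0l mulr_ge0 ?enorm_ge0.
have {}u0 : 0 < enorm u by rewrite lt_def u0 enorm_ge0.
have {}v0 : 0 < enorm v by rewrite lt_def v0 enorm_ge0.
have := dotvv_ge0 (enorm v *: u - enorm u *: v).
rewrite dotvBl !dotvBr !dotvZl !dotvZr -!sqr_enorm (dotvC v u).
have -> : enorm v * (enorm v * enorm u ^+ 2) - enorm v * (enorm u * dotv u v) -
  (enorm u * (enorm v * dotv u v) - enorm u * (enorm u * enorm v ^+ 2)) =
  2 * (enorm u * enorm v) * (enorm u * enorm v - dotv u v) by ring.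
by rewrite pmulr_rge0 ?subr_ge0// mulr_gt0// mulr_gt0.
Qed.

(** Pairing the average [v] with itself and applying Cauchy-Schwarz to each [F i] gives the bound
    multiplied by [enorm v], which is then cancelled. *)
Lemma enorm_avg_le n (F : 'I_n -> 'rV[R]_d) (x : 'I_n -> R) :
  (forall i, enorm (F i) <= x i) ->
  enorm (n%:R^-1 *: \sum_i F i) <= n%:R^-1 * \sum_i x i.
Proof.
move=> Fx; set v := _ *: _.
have [v0|v0] := eqVneq (enorm v) 0.
  rewrite v0 mulr_ge0 ?invr_ge0//; apply: sumr_ge0 => i _.
  by rewrite (le_trans _ (Fx i))// enorm_ge0.
have {}v0 : 0 < enorm v by rewrite lt_def v0 enorm_ge0.
rewrite -(ler_pM2r v0) -expr2 sqr_enorm {1}/v dotvZl dotv_suml -mulrA.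
rewrite ler_wpM2l ?invr_ge0// mulr_suml; apply: ler_sum => i _.
by rewrite (le_trans (dotv_le _ _))// ler_wpM2r ?enorm_ge0.
Qed.

Lemma enorm_clip_le z (tau : R) : 0 < tau -> enorm (clip z tau) <= tau.
Proof.
move=> tau0; rewrite /clip enormZ.
have [->|z0] := eqVneq (enorm z) 0; first by rewrite mulr0 ltW.
have {}z0 : 0 < enorm z by rewrite lt_def z0 enorm_ge0.
rewrite ger0_norm; last by rewrite le_min ler01 divr_ge0// ltW.
by rewrite -ler_pdivlMr// ge_min lexx orbT.
Qed.

(* A vector of norm at most g is moved only if tau < g, and then by at most
   g <= g (g / tau)^(k - 1). *)
Lemma enorm_subr_clip_le z (tau g k : R) : 0 < tau -> 1 < k -> enorm z <= g ->
  enorm (z - clip z tau) <= g `^ k / tau `^ (k - 1).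
Proof.
move=> tau0 k1 zg; have g0 : 0 <= g by rewrite (le_trans _ zg)// enorm_ge0.
have rhs0 : 0 <= g `^ k / tau `^ (k - 1) by rewrite divr_ge0 ?powR_ge0.
rewrite /clip -{1}[z]scale1r -scalerBl enormZ.
have [->|z0] := eqVneq (enorm z) 0; first by rewrite mulr0.
have {}z0 : 0 < enorm z by rewrite lt_def z0 enorm_ge0.
have [tz|tz] := leP 1 (tau / enorm z); first by rewrite subrr normr0 mul0r.
have {}tz : tau < enorm z by rewrite -[ltRHS]mul1r -ltr_pdivrMr.
have tg : tau < g by exact: lt_le_trans zg.
have gp : 0 < g by exact: lt_trans tg.
rewrite ger0_norm; last by rewrite subr_ge0 ler_pdivrMr// mul1r ltW.
apply: (@le_trans _ _ g).
  rewrite mulrBl mul1r divfK ?gt_eqF// (le_trans _ zg)//.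
  by rewrite gerBl ltW.
rewrite ler_pdivlMr ?powR_gt0//.
have -> : g `^ k = g * g `^ (k - 1).
  by rewrite -[X in _ = X * _](powRr1 g0) -powRD ?(gt_eqF gp) ?implybT// subrKC.
by rewrite ler_wpM2l// ge0_ler_powR ?nnegrE ?subr_ge0// ltW.
Qed.

End euclidean.

(** * The descent lemma and the gradient of the empirical risk *)

Section smooth_descent.
Context {R : realType} {d : nat}.
Implicit Types (f : 'rV[R]_d -> R) (u v w : 'rV[R]_d).

Lemma diff_dotv_grad f w u : differentiable f w -> 'd f w u = dotv (grad f w) u.
Proof.
move=> df; rewrite [u in LHS]row_sum_delta linear_sum; apply: eq_bigr => i _.
by rewrite linearZ/= mxE deriveE// mulrC.
Qed.

Lemma is_derive_along_line f w u (t : R) : differentiable f (w + t *: u) ->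
  is_derive t 1 (fun s : R => f (w + s *: u)) (dotv (grad f (w + t *: u)) u).
Proof.
move=> df; rewrite -diff_dotv_grad// -deriveE//.
(* The difference quotient at [t] along the line is the directional one of [f] at [w + t *: u]. *)
have e : (fun h : R => h^-1 *: (f (w + (h *: (1 : R) + t) *: u) - f (w + t *: u)))
   = (fun h : R => h^-1 *: (f (h *: u + (w + t *: u)) - f (w + t *: u))).
  apply/funext => h; congr (_ *: (f _ - _)).
  have -> : h *: (1 : R) = h by exact: mulr1.
  by rewrite scalerDl addrCA.
have : derivable f (w + t *: u) u by exact: diff_derivable.
rewrite /derivable -e => cf.
by apply: DeriveDef => //; rewrite /derive -e.
Qed.

(* The excess f(w + t u) - f(w) - t <grad f(w), u> - (L t^2 / 2) |u|^2 has
   nonpositive derivative for t >= 0. *)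
Lemma smooth_le_quadratic f (L : R) w u : 0 <= L ->
  (forall v, differentiable f v) ->
  (forall v v', enorm (grad f v - grad f v') <= L * enorm (v - v')) ->
  f (w + u) <= f w + dotv (grad f w) u + L / 2 * enorm u ^+ 2.
Proof.
move=> L0 df lip; set D := dotv _ _; set K := _ * enorm u ^+ 2.
pose psi (t : R) := f (w + t *: u) - t * D - t ^+ 2 * K.
pose dpsi (t : R) := dotv (grad f (w + t *: u)) u - D - 2 * t * K.
have dp (t : R) : is_derive t 1 psi (dpsi t).
  have h1 := is_derive_along_line f w u t (df (w + t *: u)).
  have -> : psi = (fun s : R => f (w + s *: u)) - D \*: @id R - K \*: (@id R ^+ 2).
    by apply/funext => s; rewrite /psi !fctE mulrC [_ * K]mulrC.
  apply: (@is_derive_eq _ _ _ _ t 1 _ _ (is_deriveB (is_deriveB h1 _) _)).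
  by rewrite /GRing.scale/= /dpsi; ring.
have [|t /[!in_itv]/= /andP[t0 t1] e] := MVT (@ltr01 R) (fun t _ => dp t).
  apply: derivable_within_continuous => t _; exact: ex_derive.
move: e; rewrite subr0 mulr1 /psi scale1r scale0r addr0 mul1r mul0r.
rewrite expr1n mul1r expr0n/= mul0r !subr0 => e.
suff : dpsi t <= 0 by rewrite -e; lra.
rewrite /dpsi /D -dotvBl subr_le0 (le_trans (dotv_le _ _))//.
apply: (@le_trans _ _ (L * enorm (t *: u) * enorm u)).
  rewrite ler_wpM2r ?enorm_ge0//; have := lip (w + t *: u) w.
  by rewrite addrAC subrr add0r.
rewrite enormZ ger0_norm; last exact: ltW.
by rewrite -subr_le0 [leLHS](_ : _ = 0)// /K; field.
Qed.

Lemma differentiable_emp_risk (T : Type) n (loss : 'rV[R]_d -> T -> R)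
    (zs : 'I_n -> T) w :
  (forall z, differentiable (fun u => loss u z) w) ->
  differentiable (emp_risk loss zs) w.
Proof.
move=> dl; have -> : emp_risk loss zs =
    (n%:R^-1 : R) *: (\sum_(i < n) (fun u => loss u (zs i))).
  by apply/funext => u; rewrite /emp_risk fctE fct_sumE.
by apply: differentiableZ; exact: differentiable_sum.
Qed.

Lemma grad_emp_risk (T : Type) n (loss : 'rV[R]_d -> T -> R)
    (zs : 'I_n -> T) w :
  (forall z, differentiable (fun u => loss u z) w) ->
  grad (emp_risk loss zs) w =
  n%:R^-1 *: \sum_(i < n) grad (fun u => loss u (zs i)) w.
Proof.
move=> dl; have e : emp_risk loss zs =
    (n%:R^-1 : R) *: (\sum_(i < n) (fun u => loss u (zs i))).
  by apply/funext => u; rewrite /emp_risk fctE fct_sumE.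
apply/rowP => j; rewrite !mxE summxE e deriveZ; last first.
  by apply: derivable_sum => i; exact: diff_derivable.
rewrite derive_sum; last by move=> i; exact: diff_derivable.
by congr (_ *: _); apply: eq_bigr => i _; rewrite mxE.
Qed.

End smooth_descent.

(** * Moments of Poisson subsampling *)

Section poisson_sampling.
Context {R : realType} (n : nat) (p : R).
Implicit Types (S A : {set 'I_n}).

Local Notation weight S := (p ^+ #|S| * (1 - p) ^+ (n - #|S|)).

Lemma poisson_weightE S : weight S = \prod_(i < n) (if i \in S then p else 1 - p).
Proof.
rewrite (bigID (mem S))/=; congr (_ * _).
  by rewrite (eq_bigr (fun=> p)) ?prodr_const// => i ->.
rewrite (eq_bigr (fun=> 1 - p)); last by move=> i /negbTE ->.
rewrite prodr_const; congr (_ ^+ _).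
have Sn : (#|S| <= n)%N by have := max_card (mem S); rewrite card_ord.
by apply: (@addnI #|S|); rewrite subnKC// [RHS](cardC (mem S)) card_ord.
Qed.

(** This is the probability that all of [A] is sampled. By independence it factors over indices: an
    index in [A] contributes [p], any other contributes [p + (1 - p) = 1]. The cases of at most two
    elements yield the total mass, the mean and the pair probabilities. *)
Lemma poisson_subset_prob A :
  \sum_(S : {set 'I_n}) weight S * (A \subset S)%:R = p ^+ #|A|.
Proof.
transitivity (\prod_(i < n) (p + (1 - p) * (i \notin A)%:R)).
  rewrite bigA_distr; apply: eq_big => [S|S _]; first by rewrite inE.
  rewrite poisson_weightE; have [AS|] := boolP (A \subset S).
    rewrite mulr1; apply: eq_bigr => i _; case: ifPn => // iS.
    by rewrite (contraNN (fintype.subsetP AS i))// mulr1.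
  move=> /subsetPn[i iA iS]; rewrite mulr0 (bigD1 i)//= (negbTE iS) iA.
  by rewrite /= mulr0 mul0r.
rewrite (bigID (mem A))/= [X in _ * X]big1 ?mulr1.
  rewrite (eq_bigr (fun=> p)) ?prodr_const// => i ->.
  by rewrite mulr0 addr0.
by move=> i ->; rewrite mulr1 subrKC.
Qed.

Lemma poisson_weight_sum : \sum_(S : {set 'I_n}) weight S = 1.
Proof.
rewrite -[RHS](expr0 p) -(cards0 'I_n) -poisson_subset_prob.
by apply: eq_bigr => S _; rewrite finset.sub0set mulr1.
Qed.

Lemma poisson_mean (x : 'I_n -> R) :
  \sum_(S : {set 'I_n}) weight S * (\sum_(i in S) x i) = p * \sum_i x i.
Proof.
under eq_bigr do rewrite big_mkcond mulr_sumr.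
rewrite exchange_big mulr_sumr; apply: eq_bigr => i _.
transitivity ((\sum_(S : {set 'I_n}) weight S * ([set i]%SET \subset S)%:R) * x i).
  rewrite mulr_suml; apply: eq_bigr => S _; rewrite finset.sub1set.
  by case: (i \in S); rewrite /= ?mulr1 ?mulr0 ?mul0r.
by rewrite poisson_subset_prob cards1 expr1.
Qed.

Lemma poisson_pair_prob_le (i j : 'I_n) : 0 <= p ->
  0 <= \sum_(S : {set 'I_n}) weight S * ((i \in S) && (j \in S))%:R <= p ^+ 2 + p *+ (i == j).
Proof.
move=> p0; have -> : \sum_(S : {set 'I_n}) weight S * ((i \in S) && (j \in S))%:R =
    p ^+ #|[set i; j]%SET|.
  rewrite -poisson_subset_prob; apply: eq_bigr => S _.
  by rewrite finset.subUset !finset.sub1set.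
rewrite exprn_ge0//= cards2; case: eqVneq => [_|_]/=; last by rewrite addr0.
by rewrite expr1 lerDr exprn_ge0.
Qed.

(** Exchanging the sums weights [x i j] by the probability that [i] and [j] are both sampled. The
    off-diagonal bound [p ^+ 2] and the extra [p] on the diagonal add up to [(n p)^2 + n p]; as
    [x i j] may be negative, the signs of the weights and of [M] matter. *)
Lemma poisson_second_moment_le (x : 'I_n -> 'I_n -> R) (M : R) : 0 <= p -> 0 <= M ->
  (forall i j, x i j <= M) ->
  \sum_(S : {set 'I_n}) weight S * (\sum_(i in S) \sum_(j in S) x i j) <=
  ((n%:R * p) ^+ 2 + n%:R * p) * M.
Proof.
move=> p0 M0 xM.
have -> : \sum_(S : {set 'I_n}) weight S * (\sum_(i in S) \sum_(j in S) x i j) =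
    \sum_i \sum_j (\sum_(S : {set 'I_n}) weight S * ((i \in S) && (j \in S))%:R) * x i j.
  under [RHS]eq_bigr do under eq_bigr do rewrite mulr_suml.
  under [RHS]eq_bigr do rewrite exchange_big.
  rewrite [RHS]exchange_big; apply: eq_bigr => S _.
  rewrite big_mkcond mulr_sumr; apply: eq_bigr => i _.
  rewrite big_mkcond; case: (i \in S); last first.
    by rewrite mulr0 big1// => j _; rewrite ?mulr0 mul0r.
  rewrite mulr_sumr; apply: eq_bigr => j _.
  by case: (j \in S); rewrite /= ?mulr1 ?mulr0 ?mul0r.
apply: (@le_trans _ _ (\sum_(i < n) \sum_(j < n) (p ^+ 2 + p *+ (i == j)) * M)).
  apply: ler_sum => i _; apply: ler_sum => j _.
  have /andP[w0 w1] := poisson_pair_prob_le i j p0.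
  by rewrite (le_trans (ler_wpM2l w0 (xM i j)))// ler_wpM2r.
under eq_bigr do rewrite -mulr_suml big_split/= sumr_const card_ord.
have e (i : 'I_n) : \sum_(j < n) p *+ (i == j) = p.
  by rewrite (bigD1 i)//= eqxx big1 ?addr0// => j /negbTE; rewrite eq_sym => ->.
under eq_bigr do rewrite e.
rewrite sumr_const card_ord -[leLHS]mulr_natl -[p ^+ 2 *+ n]mulr_natl.
by rewrite -subr_le0 [leLHS](_ : _ = 0)//; ring.
Qed.

End poisson_sampling.

(** * Expected decrease of the risk in one step *)

Section expected_decrease.
Context {R : realType} (d n : nat) (T : Type) (loss : 'rV[R]_d -> T -> R).
Variables (zs : 'I_n -> T) (b tau eta sigma2 L fmin : R).
Hypotheses (b1 : 1 <= b) (bn : b <= n%:R) (tau0 : 0 < tau) (eta0 : 0 < eta).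
Hypotheses (sigma0 : 0 < sigma2) (L0 : 0 < L).
Local Notation f := (emp_risk loss zs).
Hypothesis df : forall z w, differentiable (fun u => loss u z) w.
Hypothesis lip : forall w w',
  enorm (grad f w - grad f w') <= L * enorm (w - w').
Hypothesis fminP : forall w, fmin <= f w.
Local Notation step := (dpsgd_step loss zs b tau eta sigma2).
Local Notation cgrad w i := (clip (grad (fun u => loss u (zs i)) w) tau).
Local Notation cavg w := (n%:R^-1 *: \sum_(i < n) cgrad w i).

Let b0 : 0 < b. Proof. exact: lt_le_trans b1. Qed.
Let n0 : 0 < n%:R :> R. Proof. exact: lt_le_trans bn. Qed.

(** The descent lemma at displacement [- eta (g S + v)] is quadratic in the noise [v]; averaging
    over [v] and then over [S] gives the bound. The affine form with [kappa] and [a] fits the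
    functions [U + m c] of the telescoping. *)
Lemma dpsgd_step_risk_le (kappa a : R) (w : 'rV[R]_d) : 0 <= kappa -> 0 <= a ->
  (step (fun u => (kappa * (f u - fmin) + a)%:E) w <=
   (kappa * (f w - fmin - eta * dotv (grad f w) (cavg w)
      + L * eta ^+ 2 / 2 * (2 * tau ^+ 2 + d%:R * sigma2)) + a)%:E)%E.
Proof.
move=> kappa0 a0.
have p01 : 0 <= b / n%:R <= 1.
  by rewrite divr_ge0 ?ler_pdivrMr ?mul1r ?bn ?ltW.
have np : n%:R * (b / n%:R) = b by rewrite mulrC divfK ?gt_eqF.
pose g (S : {set 'I_n}) := b^-1 *: \sum_(i in S) cgrad w i.
(* [r S] is the bound left after averaging over the noise with the sample [S] fixed. *)
pose r (S : {set 'I_n}) := (kappa * (f w - fmin) + a)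
  - kappa * eta * dotv (grad f w) (g S)
  + kappa * (L * eta ^+ 2 / 2) * dotv (g S) (g S)
  + kappa * (L * eta ^+ 2 / 2) * (d%:R * sigma2).
pose wt (S : {set 'I_n}) := (b / n%:R) ^+ #|S| * (1 - b / n%:R) ^+ (n - #|S|).
apply: (@le_trans _ _ (\sum_(S : {set 'I_n}) wt S * r S)%:E).
  rewrite -sumEFin.
  apply: lee_sum => S _; rewrite -/(wt S) [leRHS]EFinM lee_wpmul2l//.
    by rewrite lee_fin; exact: poisson_weight_ge0.
  rewrite /r -[X in d%:R * X](sqr_sqrtr (ltW sigma0)).
  have K0 : 0 <= kappa * (L * eta ^+ 2 / 2).
    by rewrite mulr_ge0// divr_ge0// mulr_ge0 ?sqr_ge0// ltW.
  have := @gaussE_le_quadratic R (Num.sqrt sigma2) d _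
    ((kappa * (f w - fmin) + a) - kappa * eta * dotv (grad f w) (g S)
      + kappa * (L * eta ^+ 2 / 2) * dotv (g S) (g S))
    (fun i => - (kappa * eta * grad f w ord0 i)
      + kappa * (L * eta ^+ 2) * g S ord0 i)
    (kappa * (L * eta ^+ 2 / 2)).
  apply => //; first by rewrite sqrtr_gt0.
    by move=> v; rewrite lee_fin addr_ge0// mulr_ge0// subr_ge0.
  move=> v; rewrite lee_fin -/(g S); move: (g S) => gS.
  have := smooth_le_quadratic f L w (- (eta *: (gS + v))) (ltW L0)
    (fun u => differentiable_emp_risk _ _ _ _ _ (fun z => df z u)) lip.
  move=> /(ler_wpM2l kappa0) h.
  have -> : \sum_(i < d) (- (kappa * eta * grad f w ord0 i) +
      kappa * (L * eta ^+ 2) * gS ord0 i) * v ord0 i =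
    - (kappa * eta) * dotv (grad f w) v + kappa * (L * eta ^+ 2) * dotv gS v.
    rewrite !mulr_sumr -big_split/=; apply: eq_bigr => i _; ring.
  have -> : \sum_(i < d) v ord0 i ^+ 2 = dotv v v.
    by apply: eq_bigr => i _; rewrite expr2.
  move: h; rewrite sqr_enorm !dotvNl !dotvNr !dotvZl !dotvZr !dotvDl !dotvDr (dotvC v gS).
  rewrite -subr_ge0 => h; rewrite -subr_ge0; apply: le_trans h _.
  by rewrite -subr_ge0 [leRHS](_ : _ = 0)//; field.
rewrite lee_fin.
pose K := kappa * (L * eta ^+ 2 / 2).
pose c0 := kappa * (f w - fmin) + a + K * (d%:R * sigma2).
have -> : \sum_(S : {set 'I_n}) wt S * r S = c0
    - kappa * eta * (\sum_(S : {set 'I_n}) wt S * dotv (grad f w) (g S))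
    + K * \sum_(S : {set 'I_n}) wt S * dotv (g S) (g S).
  transitivity (c0 * (\sum_(S : {set 'I_n}) wt S)
      - kappa * eta * (\sum_(S : {set 'I_n}) wt S * dotv (grad f w) (g S))
      + K * \sum_(S : {set 'I_n}) wt S * dotv (g S) (g S)); last first.
    by rewrite [\sum_(S : _) wt S]poisson_weight_sum mulr1.
  rewrite !mulr_sumr -sumrN -!big_split/=; apply: eq_bigr => S _.
  by rewrite /r /c0 /K; ring.
(* Dividing by [b] and not by the size of [S] makes the subsampled mean unbiased:
   [b^-1 (b / n) = n^-1]. *)
have -> : \sum_(S : {set 'I_n}) wt S * dotv (grad f w) (g S) = dotv (grad f w) (cavg w).
  rewrite dotvZr dotv_sumr.
  transitivity (b^-1 * \sum_(S : {set 'I_n}) wt S * \sum_(i in S) dotv (grad f w) (cgrad w i)).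
    rewrite mulr_sumr; apply: eq_bigr => S _.
    by rewrite /g dotvZr dotv_sumr mulrCA.
  by rewrite poisson_mean !mulrA mulVf ?gt_eqF// mul1r.
have K0 : 0 <= K by rewrite mulr_ge0// divr_ge0// mulr_ge0 ?sqr_ge0// ltW.
have : \sum_(S : {set 'I_n}) wt S * dotv (g S) (g S) <= 2 * tau ^+ 2.
  have -> : \sum_(S : {set 'I_n}) wt S * dotv (g S) (g S) =
      b^-1 ^+ 2 * \sum_(S : {set 'I_n}) wt S *
        \sum_(i in S) \sum_(j in S) dotv (cgrad w i) (cgrad w j).
    rewrite mulr_sumr; apply: eq_bigr => S _.
    rewrite /g dotvZl dotvZr dotv_suml.
    under eq_bigr do rewrite dotv_sumr.
    ring.
  have cc i j : dotv (cgrad w i) (cgrad w j) <= tau ^+ 2.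
    rewrite (le_trans (dotv_le _ _))// expr2.
    by apply: ler_pM; rewrite ?enorm_ge0 ?enorm_clip_le.
  (* Since [n p = b], the second moment is at most [(b^2 + b) tau^2 / b^2], and [1 <= b] bounds this
     by [2 tau^2]. *)
  have := poisson_second_moment_le _ _ _ _ (proj1 (andP p01)) (sqr_ge0 tau) cc.
  move=> /(ler_wpM2l (sqr_ge0 b^-1))/le_trans; apply; rewrite np mulrA.
  rewrite ler_wpM2r ?sqr_ge0// exprVn mulrC ler_pdivrMr ?exprn_gt0//.
  rewrite -subr_ge0 [leRHS](_ : _ = b * (b - 1)); last by ring.
  by rewrite mulr_ge0 ?subr_ge0// ltW.
move=> /(ler_wpM2l K0); rewrite /c0 -subr_ge0 => h; rewrite -subr_ge0.
by apply: le_trans h _; rewrite -subr_ge0 [leRHS](_ : _ = 0)// /K; ring.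
Qed.

End expected_decrease.

(** * The optimization risk in terms of the clipping bias *)

Section dpsgd_rate.
Context {R : realType} (d n : nat) (T : Type) (loss : 'rV[R]_d -> T -> R).
Variables (zs : 'I_n -> T) (b tau eta sigma2 L fmin : R).
Hypotheses (b1 : 1 <= b) (bn : b <= n%:R) (tau0 : 0 < tau) (eta0 : 0 < eta).
Hypotheses (sigma0 : 0 < sigma2) (L0 : 0 < L).
Local Notation f := (emp_risk loss zs).
Hypothesis df : forall z w, differentiable (fun u => loss u z) w.
Hypothesis lip : forall w w',
  enorm (grad f w - grad f w') <= L * enorm (w - w').
Hypothesis fminP : forall w, fmin <= f w.
Local Notation cgrad w i := (clip (grad (fun u => loss u (zs i)) w) tau).
Local Notation cavg w := (n%:R^-1 *: \sum_(i < n) cgrad w i).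

Lemma OR_le_clip_bias (B : R) (w0 : 'rV[R]_d) (Tn : nat) : (0 < Tn)%N ->
  (forall w, enorm (grad f w - cavg w) <= B) ->
  (OR loss zs w0 Tn b tau eta sigma2 <=
   (2 / (eta * Tn%:R) * (f w0 - fmin) + B ^+ 2
     + L * eta * (2 * tau ^+ 2 + d%:R * sigma2))%:E)%E.
Proof.
move=> Tn0 biasB; have Tn0' : 0 < Tn%:R :> R by rewrite ltr0n.
set c := B ^+ 2 + L * eta * (2 * tau ^+ 2 + d%:R * sigma2).
have c0 : 0 <= c.
  apply: addr_ge0; first exact: sqr_ge0.
  apply: mulr_ge0; first by rewrite mulr_ge0// ltW.
  by rewrite addr_ge0// mulr_ge0 ?sqr_ge0// ltW.
have n0 : 0 < n%:R :> R by apply: lt_le_trans bn; exact: lt_le_trans b1.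
have p01 : 0 <= b / n%:R <= 1.
  by rewrite ler_pdivrMr ?mul1r// bn andbT divr_ge0 ?ltW// (lt_le_trans _ b1).
pose U w := 2 / eta * (f w - fmin).
have U0 w : 0 <= U w by rewrite mulr_ge0 ?subr_ge0// divr_ge0// ltW.
have := @sum_iter_dpsgd_step_le R d n T loss zs b tau eta sigma2 p01
  (fun w => (enorm (grad f w) ^+ 2)%:E) U c _ U0 c0 _ Tn w0.
move=> Hsum.
have -> : 2 / (eta * Tn%:R) * (f w0 - fmin) + B ^+ 2
     + L * eta * (2 * tau ^+ 2 + d%:R * sigma2) = Tn%:R^-1 * (U w0 + Tn%:R * c).
  by rewrite /U /c; field; rewrite !gt_eqF.
rewrite /OR EFinM lee_wpmul2l ?lee_fin ?invr_ge0//.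
apply: Hsum => [u|m w]; first by rewrite lee_fin sqr_ge0.
have mc0 : 0 <= m%:R * c by rewrite mulr_ge0.
have eta2 : 0 <= 2 / eta by rewrite divr_ge0// ltW.
apply: le_trans.
  apply: leeD2l; apply: (@dpsgd_step_risk_le R d n T loss zs b tau eta sigma2 L fmin) => //.
rewrite -EFinD lee_fin.
have : enorm (grad f w - cavg w) ^+ 2 <= B ^+ 2.
  by rewrite ler_sqr ?nnegrE ?enorm_ge0// (le_trans (enorm_ge0 _) (biasB w)).
rewrite !sqr_enorm !(dotvBl, dotvBr) (dotvC (cavg w) (grad f w)).
have := dotvv_ge0 (cavg w); rewrite /U /c -natr1.
set x := dotv (cavg w) (cavg w); set y := dotv (grad f w) (cavg w).
set z := dotv (grad f w) (grad f w) => x0 h.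
(* Polarization: [z - 2 y + x] is the squared bias, and the remaining [x], the squared norm of
   [cavg w], is nonnegative and dropped. *)
rewrite -subr_ge0 [leRHS](_ : _ = B ^+ 2 - (z - y - (y - x)) + x).
  by rewrite addr_ge0// subr_ge0.
by field; rewrite gt_eqF.
Qed.

Lemma clip_bias_le (k M : R) (g : 'I_n -> R) (w : 'rV[R]_d) : 1 < k ->
  (forall i, enorm (grad (fun u => loss u (zs i)) w) <= g i) ->
  n%:R^-1 * \sum_i g i `^ k <= M ->
  enorm (grad f w - cavg w) <= M / tau `^ (k - 1).
Proof.
move=> k1 gG gM; rewrite grad_emp_risk// -scalerBr -sumrB.
apply: le_trans; first by apply: enorm_avg_le => i;
  exact: (enorm_subr_clip_le _ _ _ _ tau0 k1 (gG i)).
by rewrite -mulr_suml mulrA ler_wpM2r// invr_ge0 powR_ge0.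
Qed.

End dpsgd_rate.

(** * The high-probability event on the dataset *)

Section heavy_tail_event.
Context {R : realType} {dT dO : measure_display}.
Context {Smp : measurableType dT} (D : probability Smp R).
Context {Omega : measurableType dO} (PO : probability Omega R).
Context {n : nat} (Z : 'I_n -> Omega -> Smp).
Hypothesis iidZ : iid_sample PO D Z.
Local Open Scope ereal_scope.

(** The product formula is applied to the family equal to [A] at [i] and to the whole space
    elsewhere. *)
Lemma iid_marginal i (A : set Smp) : measurable A -> PO (Z i @^-1` A) = D A.
Proof.
move=> mA; have [_ /(_ (fun j => if j == i then A else setT))] := iidZ.
rewrite (bigD1 i)//= eqxx big1 ?mule1; last first.
  by move=> j /negbTE ->; rewrite probability_setT.
move=> <-; last by move=> j; case: ifP.
congr (PO _); apply/seteqP; split=> [om /= Aom j|om /= /(_ i)]; last by rewrite eqxx.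
by case: eqVneq => [->|].
Qed.

Lemma ge0_integral_iid i (g : Smp -> \bar R) : measurable_fun [set: Smp] g ->
  (forall z, 0 <= g z) -> \int[PO]_om g (Z i om) = \int[D]_z g z.
Proof.
move=> mg g0; have mZ : measurable_fun [set: Omega] (Z i) by case: iidZ.
have := @ge0_integral_pushforward _ _ Omega Smp R (Z i) mZ PO setT g measurableT mg
  (fun y _ => g0 y).
rewrite preimage_setT => <-; apply: eq_measure_integral => A mA _.
exact: iid_marginal.
Qed.

Lemma measurable_sample_average_gt (g : Smp -> R) (x : R) :
  measurable_fun [set: Smp] g ->
  measurable [set om | (x < n%:R^-1 * \sum_i g (Z i om))%R].
Proof.
move=> mg; pose S om := (n%:R^-1 * \sum_i g (Z i om))%R.
have mS : measurable_fun [set: Omega] S.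
  apply: measurable_funM => //; apply: measurable_sum => i.
  by apply: measurableT_comp => //; case: iidZ.
rewrite (_ : mkset _ = S @^-1` `]x, +oo[%classic).
  by rewrite -[X in measurable X]setTI; exact: mS.
by apply/seteqP; split=> om /=; rewrite in_itv/= andbT.
Qed.

(** By linearity the average has mean at most [m]; it dominates [m / gamma] times the indicator of
    the event, and integrating gives Markov's inequality. *)
Lemma markov_sample_average (g : Smp -> R) (m gamma : R) : (0 < n)%N ->
  (0 < m)%R -> (0 < gamma)%R ->
  measurable_fun [set: Smp] g -> (forall z, 0 <= g z)%R ->
  \int[D]_z (g z)%:E <= m%:E ->
  PO [set om | (m / gamma < n%:R^-1 * \sum_i g (Z i om))%R] <= gamma%:E.
Proof.
move=> n0 m0 gamma0 mg g0 gm.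
pose S om := (n%:R^-1 * \sum_i g (Z i om))%R.
have mZ i : measurable_fun [set: Omega] (Z i) by case: iidZ.
have S0 om : (0 <= S om)%R by rewrite mulr_ge0 ?invr_ge0// sumr_ge0.
have iS : \int[PO]_om (S om)%:E <= m%:E.
  under eq_integral do rewrite EFinM.
  rewrite ge0_integralZl_EFin//; first last.
  - apply/measurable_EFinP; apply: measurable_sum => i.
    exact: measurableT_comp.
  - by move=> om _; rewrite lee_fin sumr_ge0.
  under eq_integral do rewrite -sumEFin.
  rewrite ge0_integral_sum//; first last.
  - by move=> i om _; rewrite lee_fin.
  - by move=> i; apply/measurable_EFinP; exact: measurableT_comp.
  apply: (@le_trans _ _ (n%:R^-1%:E * \sum_(i < n) m%:E)).
    rewrite lee_wpmul2l ?lee_fin ?invr_ge0//; apply: lee_sum => i _.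
    rewrite (ge0_integral_iid i (EFin \o g))//; exact/measurable_EFinP.
  rewrite sumEFin -EFinM lee_fin sumr_const card_ord -[(m *+ n)%R]mulr_natl.
  by rewrite mulKf// pnatr_eq0 -lt0n.
pose A := [set om | (m / gamma < S om)%R].
have mA : measurable A by exact: measurable_sample_average_gt.
have mg0 : (0 < m / gamma)%R by rewrite divr_gt0.
rewrite -/A -(@lee_pmul2l _ (m / gamma)%:E)//.
rewrite -EFinM divfK ?gt_eqF//; apply: le_trans iS.
rewrite -integral_cst//; rewrite integral_mkcond.
apply: ge0_le_integral_nomeas => om; rewrite patchE; case: ifPn => //.
- by rewrite lee_fin ltW.
- by rewrite inE => /ltW; rewrite lee_fin.
- by rewrite lee_fin.
Qed.

Lemma good_sample_event (g : Smp -> R) (m gamma : R) (Q : Smp -> Prop) : (0 < n)%N ->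
  (0 < m)%R -> (0 < gamma)%R ->
  measurable_fun [set: Smp] g -> (forall z, 0 <= g z)%R ->
  \int[D]_z (g z)%:E <= m%:E ->
  {ae D, forall z, Q z} ->
  exists E : set Omega, [/\ measurable E, (1 - gamma)%:E <= PO E &
    forall om, E om ->
      (forall i, Q (Z i om)) /\ (n%:R^-1 * \sum_i g (Z i om) <= m / gamma)%R].
Proof.
move=> n0 m0 gamma0 mg g0 gm [N [mN N0 QN]].
have mZ i : measurable_fun [set: Omega] (Z i) by case: iidZ.
pose A := [set om | (m / gamma < n%:R^-1 * \sum_i g (Z i om))%R].
have mA : measurable A by exact: measurable_sample_average_gt.
(* [B] says that some sample falls into the [D]-null set [N] outside which [Q] holds; as a finite
   union of null events it costs no probability. *)
pose B := \big[setU/set0]_(i < n) (Z i @^-1` N).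
have mB : measurable B.
  by apply: bigsetU_measurable => i _; rewrite -[X in measurable X]setTI; exact: mZ.
have B0 : PO B = 0.
  apply/negligibleP => //; rewrite /B; elim/big_ind : _ => //.
  - exact: negligible_set0.
  - by move=> X Y; exact: negligibleU.
  - move=> i _; apply/negligibleP; last by rewrite [LHS]iid_marginal.
    by rewrite -[X in measurable X]setTI; exact: mZ.
exists (~` (A `|` B)); split.
- by apply: measurableC; exact: measurableU.
- rewrite probability_setC; last exact: measurableU.
  rewrite measureU0// EFinB leeB//.
  exact: markov_sample_average.
- move=> om /not_orP[nA nB]; split; last by rewrite leNgt; apply/negP.
  move=> i; apply: contrapT => nQ; apply: nB.
  by rewrite /B -bigcup_seq; exists i; [rewrite /= mem_index_enum|exact: QN].
Qed.

End heavy_tail_event.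

(** * Algebra of the clipping radius, with [s] for [sqrt L] and [Q] for [1/T + phi^2] *)

Section parameter_algebra.
Context {R : realType}.
Variables (k G s gamma C Q : R).
Hypotheses (k1 : 1 < k) (G0 : 0 < G) (s0 : 0 < s) (gamma0 : 0 < gamma).
Hypotheses (C0 : 0 < C) (Q0 : 0 < Q).
Local Notation kk := ((2 * k - 1)^-1).
Let tau : R := G * (G / (gamma ^+ 2 * C * s)) `^ kk * Q `^ (- (kk / 2)).

Lemma two_mul_sub1_gt0 : 0 < 2 * k - 1.
Proof. by move: k1; lra. Qed.

Lemma clip_radius_gt0 : 0 < tau.
Proof. by rewrite !mulr_gt0 ?powR_gt0 ?divr_gt0 ?mulr_gt0 ?exprn_gt0. Qed.

(** In logarithms, the identities between real powers below become linear in [ln G], [ln gamma],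
    [ln C], [ln s] and [ln Q], with coefficients rational in [k]. *)
Lemma ln_clip_radius :
  ln tau = ln G + kk * (ln G - 2 * ln gamma - ln C - ln s) - kk / 2 * ln Q.
Proof.
have g2 : 0 < gamma ^+ 2 by rewrite exprn_gt0.
have g2C : 0 < gamma ^+ 2 * C by rewrite mulr_gt0.
have g2Cs : 0 < gamma ^+ 2 * C * s by rewrite mulr_gt0.
rewrite /tau !lnM ?posrE ?mulr_gt0 ?powR_gt0 ?divr_gt0 ?invr_gt0//.
rewrite !ln_powR ln_div ?posrE// !lnM ?posrE//.
by ring.
Qed.

Lemma ln_inj_gt0 (x y : R) : 0 < x -> 0 < y -> ln x = ln y -> x = y.
Proof. by move=> x0 y0; apply: ln_inj; rewrite posrE. Qed.

(* The clipping radius is the one that balances the clipping bias and the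
   optimisation error. *)
Lemma clip_radius_balance :
  (G `^ k / gamma / tau `^ (k - 1)) ^+ 2 = s * C * tau * Q `^ 2^-1.
Proof.
move: clip_radius_gt0 ln_clip_radius; move: tau => t t0 lnt; apply: ln_inj_gt0.
- by rewrite exprn_gt0// !divr_gt0 ?powR_gt0.
- by rewrite !mulr_gt0 ?powR_gt0//.
rewrite lnXn ?divr_gt0 ?powR_gt0// -mulr_natl.
rewrite !ln_div ?posrE ?divr_gt0 ?powR_gt0//.
rewrite !lnM ?posrE ?mulr_gt0 ?powR_gt0// !ln_powR lnt.
by field; rewrite gt_eqF// two_mul_sub1_gt0.
Qed.

(** The left side is the common factor of the error terms once [tau] balances them; the right side
    is its form in the final rate. *)
Lemma clip_radius_rate :
  s * tau * Q `^ 2^-1 =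
  s `^ (1 - kk) * G `^ (1 + kk) / (gamma `^ (2 * kk) * C `^ kk) *
    Q `^ (2^-1 * (1 - kk)).
Proof.
move: clip_radius_gt0 ln_clip_radius; move: tau => t t0 lnt; apply: ln_inj_gt0.
- by rewrite !mulr_gt0 ?powR_gt0//.
- by apply: mulr_gt0; [apply: divr_gt0; apply: mulr_gt0|]; exact: powR_gt0.
rewrite !lnM ?posrE ?(invr_gt0, mulr_gt0, powR_gt0)// lnV ?posrE ?mulr_gt0 ?powR_gt0//.
rewrite !lnM ?posrE ?powR_gt0// !ln_powR lnt.
by field; rewrite gt_eqF// two_mul_sub1_gt0.
Qed.

End parameter_algebra.

(** * From the moment condition to the final rate *)

Lemma poweR_inv_le {R : realType} (x : \bar R) (k y : R) : 0 < k -> 0 <= y ->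
  (0 <= x)%E -> (x `^ k^-1 <= y%:E)%E -> (x <= (y `^ k)%:E)%E.
Proof.
move=> k0 y0; case: x => [r| |]//.
  rewrite !lee_fin => r0 ry.
  rewrite -[leLHS](powRr1 r0) -(mulVf (lt0r_neq0 k0)) powRrM.
  by rewrite ge0_ler_powR ?nnegrE ?powR_ge0// ltW.
by rewrite poweRyr ?invr_eq0 ?gt_eqF// leye_eq.
Qed.

Theorem mainTheorem7 (R : realType)
  (dT : measure_display) (Smp : measurableType dT) (D : probability Smp R)
  (dO : measure_display) (Omega : measurableType dO) (PO : probability Omega R)
  (d n : nat) (loss : 'rV[R]_d -> Smp -> R) (Gf : Smp -> R)
  (k G L gamma C eps delta nu b : R) (Tn : nat) (w0 : 'rV[R]_d)
  (Z : 'I_n -> Omega -> Smp) :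
  (* loss differentiable in w *)
  (forall z w, differentiable (fun u => loss u z) w) ->
  (* gradient envelope G(x,y) >= 0, bound on the support of D *)
  measurable_fun [set: Smp] Gf ->
  (forall z, 0 <= Gf z) ->
  {ae D, forall z, forall w, enorm (grad (fun u => loss u z) w) <= Gf z} ->
  1 < k -> 0 < G ->
  ((\int[D]_z ((Gf z) `^ k)%:E) `^ k^-1 <= G%:E)%E ->
  (* i.i.d. sample of size n *)
  (0 < n)%N -> iid_sample PO D Z ->
  (* f is L-smooth and attains its minimum (for every realization of the data) *)
  0 < L ->
  (forall om w w', enorm (grad (emp_risk loss (fun i => Z i om)) w
                          - grad (emp_risk loss (fun i => Z i om)) w') <= L * enorm (w - w')) ->
  (forall om, exists wmin, forall w,
      emp_risk loss (fun i => Z i om) wmin <= emp_risk loss (fun i => Z i om) w) ->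
  (* parameters *)
  0 < gamma < 1 -> 0 < C -> (1 <= Tn)%N ->
  0 < eps -> 0 < delta < 1 -> 0 < nu -> 1 <= b <= n%:R ->
  let phi := Num.sqrt (nu * d%:R * ln delta^-1) / (n%:R * eps) in
  let Q := Tn%:R^-1 + phi ^+ 2 in
  let kk := (2 * k - 1)^-1 in
  let tau := G * (G / (gamma ^+ 2 * C * Num.sqrt L)) `^ kk * Q `^ (- (kk / 2)) in
  let eta := C / (Tn%:R * tau * Num.sqrt L) * Q `^ (- 2^-1) in
  let sigma2 := nu * Tn%:R * ln delta^-1 * tau ^+ 2 / (n%:R ^+ 2 * eps ^+ 2) in
  exists E : set Omega, measurable E /\ (PO E >= (1 - gamma)%:E)%E /\
    forall om, E om ->
      let zs := fun i => Z i om in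
      let f := emp_risk loss zs in
      let gap := f w0 - inf (range f) in
      (OR loss zs w0 Tn b tau eta sigma2 <=
        ((Num.sqrt L) `^ (1 - kk) * G `^ (1 + kk) / (gamma `^ (2 * kk) * C `^ kk)
         * (3 * C + 2 * gap / C) * Q `^ (2^-1 * (1 - kk)))%:E)%E /\
      (Tn%:R = phi ^- 2 ->
       (OR loss zs w0 Tn b tau eta sigma2 <=
        ((Num.sqrt (2 * L)) `^ (1 - kk) * G `^ (1 + kk) / (gamma `^ (2 * kk) * C `^ kk)
         * (3 * C + 2 * gap / C) * phi `^ (1 - kk))%:E)%E).

Proof.
move=> dl mG G_ge0 gradG k1 G0 intG n0 iid L0 lip minf gamma01 C0 Tn1 eps0 delta01
  nu0 bn phi Q kk; set s := Num.sqrt L; move=> tau eta sigma2.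
have /andP[gamma0 gamma1] := gamma01; have /andP[delta0 delta1] := delta01.
have /andP[b1 bn1] := bn; have k0 : 0 < k by exact: lt_trans k1.
have nR0 : 0 < n%:R :> R by rewrite ltr0n.
have TR0 : 0 < Tn%:R :> R by rewrite ltr0n.
have s0 : 0 < s by rewrite sqrtr_gt0.
have s2 : s ^+ 2 = L by rewrite sqr_sqrtr// ltW.
have lnd : 0 < ln delta^-1 by rewrite ln_gt0// invf_gt1.
have Q0 : 0 < Q by rewrite ltr_wpDr ?sqr_ge0// invr_gt0.
have tau0 : 0 < tau by exact: clip_radius_gt0.
set q := Q `^ 2^-1; have q0 : 0 < q by rewrite powR_gt0.
have q2 : q ^+ 2 = Q.
  by rewrite -powR_mulrn ?powR_ge0// -powRrM mulVf ?pnatr_eq0// powRr1// ltW.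
have etaE : eta = C / (Tn%:R * tau * s * q).
  by rewrite /eta powRN -/q -mulrA -invfM.
have eta0 : 0 < eta.
  rewrite etaE; apply: divr_gt0 => //.
  by apply: mulr_gt0 => //; apply: mulr_gt0 => //; exact: mulr_gt0.
have sigma0 : 0 < sigma2.
  apply: divr_gt0; apply: mulr_gt0; rewrite ?exprn_gt0//.
  by apply: mulr_gt0 => //; exact: mulr_gt0.
have phi2 : phi ^+ 2 = nu * d%:R * ln delta^-1 / (n%:R ^+ 2 * eps ^+ 2).
  rewrite expr_div_n sqr_sqrtr ?exprMn//.
  apply: mulr_ge0; last exact: ltW.
  by apply: mulr_ge0 => //; exact: ltW.
(* The total noise variance of one step, through which [phi] enters the rate. *)
have dsigma : d%:R * sigma2 = Tn%:R * phi ^+ 2 * tau ^+ 2.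
  by rewrite phi2 /sigma2; field; rewrite !gt_eqF.
have mGk : measurable_fun [set: Smp] (fun z => Gf z `^ k).
  exact: measurableT_comp (measurable_powR _) mG.
have intGk : (\int[D]_z (Gf z `^ k)%:E <= (G `^ k)%:E)%E.
  apply: poweR_inv_le => //; first exact: ltW.
  by apply: integral_ge0 => z _; rewrite lee_fin powR_ge0.
have [E [mE PE good]] := @good_sample_event R dT dO Smp D Omega PO n Z iid
  (fun z => Gf z `^ k) (G `^ k) gamma
  (fun z => forall w, enorm (grad (fun u => loss u z) w) <= Gf z)
  n0 (powR_gt0 _ G0) gamma0 mGk (fun z => powR_ge0 _ _) intGk gradG.
exists E; split => //; split => // om Eom zs f gap.
have [gz avgG] := good om Eom.
have fminP w : inf (range f) <= f w.
  (* [inf] is a lower bound only for a set bounded below; the minimizer provides such a bound. *)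
  apply: ge_inf; last by exists w.
  have [wmin hmin] := minf om; exists (f wmin) => _ [u _ <-]; exact: hmin.
have gap0 : 0 <= gap by rewrite subr_ge0.
set B := G `^ k / gamma / tau `^ (k - 1).
have main : (OR loss zs w0 Tn b tau eta sigma2 <=
    (s * tau * q * (3 * C + 2 * gap / C))%:E)%E.
  have bias w : enorm (grad f w - n%:R^-1 *:
      \sum_(i < n) clip (grad (fun u => loss u (zs i)) w) tau) <= B.
    exact: (clip_bias_le d n Smp loss zs tau tau0 dl k _ (fun i => Gf (zs i)) w
      k1 (fun i => gz i w) avgG).
  apply: (le_trans (@OR_le_clip_bias R d n Smp loss zs b tau eta sigma2 L
    (inf (range f)) b1 bn1 tau0 eta0 sigma0 L0 dl (lip om) fminP B w0 Tn Tn1 bias)).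
  rewrite -/gap lee_fin dsigma [B ^+ 2]clip_radius_balance// -/kk -/tau -/q.
  rewrite -s2 etaE -subr_ge0.
  (* In units of [s tau q], the squared bias contributes [C], the initial gap [2 gap / C], and the
     variance at most [2 C]. Since [2 / T + phi^2 = 2 q^2 - phi^2], the slack in the last bound is
     exactly this term. *)
  rewrite [leRHS](_ : _ = s * C * tau / q * phi ^+ 2).
    apply: mulr_ge0; last exact: sqr_ge0.
    by apply: divr_ge0; rewrite ltW//; apply: mulr_gt0 => //; exact: mulr_gt0.
  have -> : phi ^+ 2 = q ^+ 2 - Tn%:R^-1 by rewrite q2 /Q addrC addKr.
  by field; rewrite !gt_eqF.
have rate : s * tau * q * (3 * C + 2 * gap / C) =
    s `^ (1 - kk) * G `^ (1 + kk) / (gamma `^ (2 * kk) * C `^ kk)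
      * (3 * C + 2 * gap / C) * Q `^ (2^-1 * (1 - kk)).
  by rewrite [s * tau * q]clip_radius_rate// -/kk mulrAC.
split; first by rewrite -rate.
move=> Tphi; apply: (le_trans main); rewrite rate lee_fin.
(* If [phi] were 0, the convention [0^-1 = 0] would turn the hypothesis into [T = 0]. *)
have phi_neq0 : phi != 0.
  apply: contraTneq TR0 => phi0.
  by rewrite Tphi phi0 expr0n/= invr0 ltxx.
have phi_ge0 : 0 <= phi by rewrite divr_ge0 ?sqrtr_ge0// mulr_ge0// ltW.
(* Both summands of [Q] now equal [phi ^+ 2]; the factor 2 is what turns [sqrt L] into
   [sqrt (2 L)]. *)
have QE : Q = 2 * phi ^+ 2 by rewrite /Q Tphi invrK mulr2n mulrDl mul1r.
have -> : Q `^ (2^-1 * (1 - kk)) = (Num.sqrt 2) `^ (1 - kk) * phi `^ (1 - kk).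
  rewrite powRrM QE powRM ?sqr_ge0// powRM ?powR_ge0// !powR12_sqrt ?sqr_ge0//.
  by rewrite sqrtr_sqr ger0_norm.
rewrite sqrtrM// -/s [(_ * s) `^ _]powRM ?sqrtr_ge0//.
rewrite -subr_ge0 [leRHS](_ : _ = 0)//.
by ring.
Qed.
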